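(* Let $(X^n,g)$ be a complete Riemannian manifold of dimension $n$. If $E$ is a vector bundle over $X$ equipped with a Clifford action of $TX$, then there exists a constant $c_n>0$ depending only on $n$ such that, for any smooth section $\xi$ of $E$, $$\big|\nabla|\xi|\big|^2\leq\frac{n-1}{n}|\nabla\xi|^2+c_n|D\xi|^2+c_n|D\xi|\,|\nabla\xi| .$$
   Context: Here $\nabla$ is a connection on $E$, $c$ denotes the Clifford action of $TX$ on $E$, and $D=\sum_{i=1}^n c(e_i)\nabla_{e_i}$ is the Dirac operator, where $\{e_i\}_{i=1}^n$ is a local orthonormal frame of $TX$. The derivative $\nabla\xi$ is regarded as a section of $TX\otimes E$, and $|\cdot|$ denotes the pointwise norms on $E$, $TX$ and $TX\otimes E$; $\nabla|\xi|$ is the gradient of the function $|\xi|$.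
   Formalization: The connection is assumed compatible with the fibre metric of E and the Clifford action skew-adjoint, as usual for Dirac operators (the inequality fails otherwise); it is claimed at points where ξ does not vanish or |ξ| is differentiable. *)

(* Defs.v *)
From HB Require Import structures.
From mathcomp Require Import all_boot all_order all_algebra.
From mathcomp Require Import all_classical all_reals all_analysis.
Set Implicit Arguments.
Unset Strict Implicit.
Unset Printing Implicit Defensive.
Import Order.TTheory GRing.Theory Num.Theory numFieldNormedType.Exports.
Local Open Scope classical_set_scope.
Local Open Scope ring_scope.

(* Meaningful for U open. In the successor case f is C^(k+1) iff it is
   differentiable with all its directional derivatives C^k, since the domain
   will be finite-dimensional. *)
Fixpoint Ck_on (R : realType) (V W : normedModType R) (k : nat) (U : set V)
    (f : V -> W) : Prop :=
  if k is k'.+1 then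
    (forall x, U x -> differentiable f x) /\ (forall v, Ck_on k' U ('D_v f))
  else forall x, U x -> {for x, continuous f}.

Definition smooth_in (R : realType) (V W : normedModType R) (U : set V)
  (f : V -> W) : Prop := forall k, Ck_on k U f.

(* A chart is given by total maps [chart i] and [param i], only relevant on
   [chart_dom i] and on its image, where they are mutually inverse
   homeomorphisms. The atlas comes with a preferred chart around each point,
   which is used to represent tangent vectors. *)
Record manifold (R : realType) (n : nat) := Manifold {
  points :> topologicalType ;
  points_hausdorff : hausdorff_space points ;
  points_second_countable : @second_countable points ;
  chart_index : Type ;
  chart_dom : chart_index -> set points ;
  chart : chart_index -> points -> 'rV[R]_n ;
  param : chart_index -> 'rV[R]_n -> points ;
  chart_at : points -> chart_index ;
  chart_atP : forall x, chart_dom (chart_at x) x ;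
  chart_dom_open : forall i, open (chart_dom i) ;
  chart_image_open : forall i, open (chart i @` chart_dom i) ;
  chartK : forall i x, chart_dom i x -> param i (chart i x) = x ;
  chart_continuous : forall i x, chart_dom i x -> {for x, continuous (chart i)} ;
  param_continuous : forall i x, chart_dom i x ->
    {for chart i x, continuous (param i)} ;
  transition_smooth : forall i j,
    smooth_in (chart i @` (chart_dom i `&` chart_dom j)) (chart j \o param i)
}.

(* The tangent space at x is 'rV[R]_n, a vector being identified with its
   coordinates in the preferred chart at x. *)
Definition tangent (R : realType) (n : nat) (M : manifold R n) (x : M) :
  lmodType R := 'rV[R]_n.

Definition tangent_basis (R : realType) (n : nat) (M : manifold R n) (x : M)
  (i : 'I_n) : tangent x := delta_mx 0 i.

(* Coordinates in the chart i of a tangent vector at x. *)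
Definition tangent_coord (R : realType) (n : nat) (M : manifold R n)
    (i : chart_index M) (x : M) (v : tangent x) : 'rV[R]_n :=
  'D_v (chart i \o param (chart_at x)) (chart (chart_at x) x).

Definition vector_field (R : realType) (n : nat) (M : manifold R n) :=
  forall x : M, tangent x.

Definition smooth_on (R : realType) (n : nat) (M : manifold R n)
    (W : normedModType R) (O : set M) (f : M -> W) : Prop :=
  forall i, smooth_in (chart i @` (chart_dom i `&` O)) (f \o param i).

Definition smooth_field_on (R : realType) (n : nat) (M : manifold R n)
    (O : set M) (Y : vector_field M) : Prop :=
  forall i, smooth_on (chart_dom i `&` O) (fun x => tangent_coord i (Y x)).

Definition differentiable_at (R : realType) (n : nat) (M : manifold R n)
    (f : M -> R) (x : M) : Prop :=
  differentiable (f \o param (chart_at x)) (chart (chart_at x) x).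

Definition mdiff (R : realType) (n : nat) (M : manifold R n)
    (f : M -> R) (x : M) (v : tangent x) : R :=
  'D_v (f \o param (chart_at x)) (chart (chart_at x) x).

Record riemannian_metric (R : realType) (n : nat) (M : manifold R n) :=
  RiemannianMetric {
  metric :> forall x : M, tangent x -> tangent x -> R ;
  metric_sym : forall x u v, @metric x u v = metric v u ;
  metric_linear : forall x (a : R) u v w,
    @metric x (a *: u + v) w = a * metric u w + metric v w ;
  metric_pos : forall x v, v <> 0 -> 0 < @metric x v v ;
  metric_smooth : forall (O : set M) (Y Z : vector_field M), open O ->
    smooth_field_on O Y -> smooth_field_on O Z ->
    smooth_on O ((fun x => metric (Y x) (Z x)) : M -> R)
}.

Definition velocity (R : realType) (n : nat) (M : manifold R n)
    (gamma : R -> M) (t : R) : tangent (gamma t) :=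
  derive1 (chart (chart_at (gamma t)) \o gamma) t.

Definition C1_curve (R : realType) (n : nat) (M : manifold R n)
    (gamma : R -> M) : Prop :=
  continuous gamma /\
  forall i t, chart_dom i (gamma t) ->
    derivable (chart i \o gamma) t 1 /\
    {for t, continuous (derive1 (chart i \o gamma))}.

Definition curve_length (R : realType) (n : nat) (M : manifold R n)
    (g : riemannian_metric M) (gamma : R -> M) : \bar R :=
  (\int[@lebesgue_measure R]_(t in `[0%R, 1%R])
     (Num.sqrt (g (gamma t) (velocity gamma t) (velocity gamma t)))%:E)%E.

(* Since a piecewise C^1 curve can be reparametrized, with the same length, so
   as to be C^1 on the whole line, this is the usual Riemannian distance
   (+oo between different connected components). *)
Definition riemannian_dist (R : realType) (n : nat) (M : manifold R n)
    (g : riemannian_metric M) (x y : M) : \bar R :=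
  ereal_inf [set curve_length g gamma | gamma in
    [set gamma | [/\ C1_curve gamma, gamma 0 = x & gamma 1 = y]]].

Definition complete_metric (R : realType) (n : nat) (M : manifold R n)
    (g : riemannian_metric M) : Prop :=
  forall u : nat -> M,
    (forall eps : R, 0 < eps -> exists N, forall j k, (N <= j)%N -> (N <= k)%N ->
       (riemannian_dist g (u j) (u k) < eps%:E)%E) ->
    exists x : M, u @ \oo --> x.

Definition local_orthonormal_frame (R : realType) (n : nat) (M : manifold R n)
    (g : riemannian_metric M) (O : set M) (e : 'I_n -> vector_field M) : Prop :=
  [/\ open O, (forall i, smooth_field_on O (e i)) &
   forall x, O x -> forall i j, g x (e i x) (e j x) = (i == j)%:R].

Definition inverse_gram (R : realType) (n : nat) (M : manifold R n)
    (g : riemannian_metric M) (x : M) : 'M[R]_n :=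
  invmx (\matrix_(i, j) g x (tangent_basis x i) (tangent_basis x j)).

(* In coordinates, (grad f)^i = \sum_j g^{ij} \partial_j f. *)
Definition gradient (R : realType) (n : nat) (M : manifold R n)
    (g : riemannian_metric M) (f : M -> R) (x : M) : tangent x :=
  \sum_i (\sum_j inverse_gram g x i j * mdiff f (tangent_basis x j))
    *: tangent_basis x i.

Definition tangent_norm (R : realType) (n : nat) (M : manifold R n)
    (g : riemannian_metric M) (x : M) (v : tangent x) : R :=
  Num.sqrt (g x v v).

Record vector_bundle (R : realType) (n : nat) (M : manifold R n) :=
  VectorBundle {
  rank : nat ;
  fibre :> M -> lmodType R ;
  triv_index : Type ;
  triv_dom : triv_index -> set M ;
  triv : triv_index -> forall x, fibre x -> 'rV[R]_rank ;
  triv_inv : triv_index -> forall x, 'rV[R]_rank -> fibre x ;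
  triv_dom_open : forall j, open (triv_dom j) ;
  triv_cover : forall x, exists j, triv_dom j x ;
  triv_linear : forall j x, triv_dom j x -> linear (@triv j x) ;
  trivK : forall j x, triv_dom j x -> cancel (@triv j x) (@triv_inv j x) ;
  triv_invK : forall j x, triv_dom j x -> cancel (@triv_inv j x) (@triv j x) ;
  triv_smooth : forall j k (w : 'rV[R]_rank),
    smooth_on (triv_dom j `&` triv_dom k)
      (fun x => triv k (@triv_inv j x w))
}.

Definition section (R : realType) (n : nat) (M : manifold R n)
  (E : vector_bundle M) := forall x : M, E x.

Definition smooth_section_on (R : realType) (n : nat) (M : manifold R n)
    (E : vector_bundle M) (O : set M) (xi : section E) : Prop :=
  forall j : triv_index E, smooth_on (triv_dom j `&` O) (fun x => triv j (xi x)).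

Definition smooth_section (R : realType) (n : nat) (M : manifold R n)
  (E : vector_bundle M) (xi : section E) : Prop := smooth_section_on setT xi.

Record bundle_metric (R : realType) (n : nat) (M : manifold R n)
    (E : vector_bundle M) := BundleMetric {
  inner :> forall x : M, E x -> E x -> R ;
  inner_sym : forall x a b, @inner x a b = inner b a ;
  inner_linear : forall x (t : R) a b b',
    @inner x (t *: a + b) b' = t * inner a b' + inner b b' ;
  inner_pos : forall x a, a <> 0 -> 0 < @inner x a a ;
  inner_smooth : forall (O : set M) (xi eta : section E), open O ->
    smooth_section_on O xi -> smooth_section_on O eta ->
    smooth_on O ((fun x => inner (xi x) (eta x)) : M -> R)
}.

Definition fibre_norm (R : realType) (n : nat) (M : manifold R n)
    (E : vector_bundle M) (h : bundle_metric E) (x : M) (a : E x) : R :=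
  Num.sqrt (h x a a).

(* Given [cliff_square], [cliff_skew] is equivalent to unit tangent vectors acting
   by isometries of the fibres. *)
Record clifford_action (R : realType) (n : nat) (M : manifold R n)
    (g : riemannian_metric M) (E : vector_bundle M) (h : bundle_metric E) :=
  CliffordAction {
  cliff :> forall x : M, tangent x -> E x -> E x ;
  cliff_linearl : forall x (a : E x), linear (fun v : tangent x => cliff v a) ;
  cliff_linearr : forall x (v : tangent x), linear (cliff v) ;
  cliff_square : forall x (v : tangent x) (a : E x),
    cliff v (cliff v a) = - g x v v *: a ;
  cliff_skew : forall x (v : tangent x) (a b : E x),
    h x (cliff v a) b = - h x a (cliff v b) ;
  cliff_smooth : forall (O : set M) (Y : vector_field M) (xi : section E),
    open O -> smooth_field_on O Y -> smooth_section_on O xi ->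
    smooth_section_on O (fun x => cliff (Y x) (xi x))
}.

(* [nabla xi x v] is the covariant derivative of xi at x in the direction v; its
   value is only meaningful for smooth sections xi. *)
Record metric_connection (R : realType) (n : nat) (M : manifold R n)
    (E : vector_bundle M) (h : bundle_metric E) := MetricConnection {
  nabla :> section E -> forall x : M, tangent x -> E x ;
  nabla_linear : forall xi x, smooth_section xi -> linear (@nabla xi x) ;
  nabla_add : forall xi eta x (v : tangent x),
    smooth_section xi -> smooth_section eta ->
    nabla (fun y => xi y + eta y) v = nabla xi v + nabla eta v ;
  nabla_leibniz : forall (f : M -> R) xi x (v : tangent x),
    smooth_on setT f -> smooth_section xi ->
    nabla (fun y => f y *: xi y) v = mdiff f v *: xi x + f x *: nabla xi v ;
  nabla_smooth : forall (O : set M) (Y : vector_field M) xi, open O ->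
    smooth_field_on O Y -> smooth_section xi ->
    smooth_section_on O (fun x => nabla xi (Y x)) ;
  nabla_metric : forall xi eta x (v : tangent x),
    smooth_section xi -> smooth_section eta ->
    mdiff (fun y => h y (xi y) (eta y)) v =
      h x (nabla xi v) (eta x) + h x (xi x) (nabla eta v)
}.

(* t represents \sum_i b_i \otimes t_i, where b is [tangent_basis x]. *)
Definition tangent_tensor (R : realType) (n : nat) (M : manifold R n)
  (E : vector_bundle M) (x : M) := 'I_n -> E x.

(* The norm of the inner product for which
   <u \otimes a, v \otimes b> = g(u, v) h(a, b). *)
Definition tensor_norm (R : realType) (n : nat) (M : manifold R n)
    (g : riemannian_metric M) (E : vector_bundle M) (h : bundle_metric E)
    (x : M) (t : tangent_tensor E x) : R :=
  Num.sqrt (\sum_i \sum_j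
    g x (tangent_basis x i) (tangent_basis x j) * h x (t i) (t j)).

(* [nabla xi], a section of T*X \otimes E, viewed in TX \otimes E via g. *)
Definition covariant_derivative (R : realType) (n : nat) (M : manifold R n)
    (g : riemannian_metric M) (E : vector_bundle M) (h : bundle_metric E)
    (D : metric_connection h) (xi : section E) (x : M) : tangent_tensor E x :=
  fun i => \sum_j inverse_gram g x i j *: D xi x (tangent_basis x j).

Definition dirac_operator (R : realType) (n : nat) (M : manifold R n)
    (g : riemannian_metric M) (E : vector_bundle M) (h : bundle_metric E)
    (D : metric_connection h) (c : clifford_action g h)
    (e : 'I_n -> vector_field M) (xi : section E) : section E :=
  fun x => \sum_i c x (e i x) (D xi x (e i x)).

(* Main.v *)
(** Where xi does not vanish, the gradient of |xi| has components
    p_i = <nabla_{e_i} xi, xi> / |xi|; where it vanishes, |xi| has a minimum and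
    its gradient is zero. With v = grad |xi|, project v (x) xi onto the kernel
    of Clifford multiplication TX (x) E -> E: up to the factor n this gives
    T = \sum_i e_i (x) (n p_i xi + c(e_i) c(v) xi), for which
    |T|^2 = n (n - 1) |v|^2 |xi|^2  and
    <nabla xi, T> = n |v|^2 |xi| - <D xi, c(v) xi>.
    Cauchy-Schwarz then yields n |v| <= sqrt (n (n - 1)) |nabla xi| + |D xi|,
    and squaring gives the claim with c_n = 2. *)
From HB Require Import structures.
Require Import Defs.
From mathcomp Require Import all_boot all_order all_algebra.
From mathcomp Require Import all_classical all_reals all_analysis.
From mathcomp Require Import ring lra.
Import Order.TTheory GRing.Theory Num.Theory numFieldNormedType.Exports.
Local Open Scope classical_set_scope.
Local Open Scope ring_scope.

(** * Inner products and Cauchy-Schwarz *)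

Record inner_product (R : realFieldType) (V : lmodType R) (h : V -> V -> R) :
  Prop := InnerProduct {
  ip_sym : forall a b, h a b = h b a ;
  ip_linear : forall t a b c, h (t *: a + b) c = t * h a c + h b c ;
  ip_ge0 : forall a, 0 <= h a a
}.

Lemma ipDl {R : realFieldType} {V : lmodType R} {h : V -> V -> R}
    (hP : inner_product R V h) a b c : h (a + b) c = h a c + h b c.
Proof. by rewrite -[a]scale1r (ip_linear _ _ _ hP) mul1r scale1r. Qed.

Lemma ip0l {R : realFieldType} {V : lmodType R} {h : V -> V -> R}
    (hP : inner_product R V h) c : h 0 c = 0.
Proof. by apply: (addrI (h 0 c)); rewrite -(ipDl hP) !addr0. Qed.

Lemma ipZl {R : realFieldType} {V : lmodType R} {h : V -> V -> R}
    (hP : inner_product R V h) t a c : h (t *: a) c = t * h a c.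
Proof. by rewrite -[t *: a]addr0 (ip_linear _ _ _ hP) (ip0l hP) addr0. Qed.

Lemma ip_suml {R : realFieldType} {V : lmodType R} {h : V -> V -> R}
    (hP : inner_product R V h) (I : finType) (a : I -> V) c :
  h (\sum_i a i) c = \sum_i h (a i) c.
Proof.
by apply: (big_morph (h^~ c)) => [u v|]; rewrite ?(ipDl hP) ?(ip0l hP).
Qed.

Lemma ipDr {R : realFieldType} {V : lmodType R} {h : V -> V -> R}
    (hP : inner_product R V h) a b c : h c (a + b) = h c a + h c b.
Proof. by rewrite ip_sym// (ipDl hP) !(ip_sym _ _ _ hP c). Qed.

Lemma ipZr {R : realFieldType} {V : lmodType R} {h : V -> V -> R}
    (hP : inner_product R V h) t a c : h c (t *: a) = t * h c a.
Proof. by rewrite ip_sym// (ipZl hP) (ip_sym _ _ _ hP c). Qed.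

Lemma ip_sumr {R : realFieldType} {V : lmodType R} {h : V -> V -> R}
    (hP : inner_product R V h) (I : finType) (a : I -> V) c :
  h c (\sum_i a i) = \sum_i h c (a i).
Proof.
by rewrite ip_sym// (ip_suml hP); apply: eq_bigr => i _; rewrite ip_sym.
Qed.

Lemma ip_sum_scale {R : realFieldType} {V : lmodType R} {h : V -> V -> R}
    (hP : inner_product R V h) (I J : finType) (s : I -> R) (t : J -> R)
    (a : I -> V) (b : J -> V) :
  h (\sum_i s i *: a i) (\sum_j t j *: b j) =
  \sum_i \sum_j s i * t j * h (a i) (b j).
Proof.
rewrite (ip_suml hP); apply: eq_bigr => i _; rewrite (ipZl hP) (ip_sumr hP).
by rewrite mulr_sumr; apply: eq_bigr => j _; rewrite (ipZr hP) mulrA.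
Qed.

(** The squared norm [Q s] of a - s b is nonnegative for every s. Families allow the use for
    tensors, indexed by a frame, and for single vectors, with ['I_1]. *)
Lemma ip_cauchy_schwarz {R : realFieldType} {V : lmodType R} {h : V -> V -> R}
    (hP : inner_product R V h) (I : finType) (a b : I -> V) :
  (\sum_i h (a i) (b i)) ^+ 2 <=
  (\sum_i h (a i) (a i)) * (\sum_i h (b i) (b i)).
Proof.
set A := \sum_i h (a i) (a i); set B := \sum_i h (a i) (b i).
set C := \sum_i h (b i) (b i).
have Q s : 0 <= A - 2 * s * B + s ^+ 2 * C.
  have -> : A - 2 * s * B + s ^+ 2 * C =
      \sum_i h (- s *: b i + a i) (- s *: b i + a i).
    rewrite /A /B /C !mulr_sumr -sumrB -big_split; apply: eq_bigr => i _ /=.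
    rewrite !(ipDl hP) !(ipDr hP) !(ipZl hP) !(ipZr hP).
    by rewrite (ip_sym _ _ _ hP (b i)); ring.
  by apply: sumr_ge0 => i _; exact: ip_ge0.
have C0 : 0 <= C by apply: sumr_ge0 => i _; exact: ip_ge0.
have [C0'|C0'] := eqVneq C 0.
  rewrite C0' mulr0; have [->|B0] := eqVneq B 0; first by rewrite expr0n.
  (* With [C = 0], [Q s] is affine in s with slope -2B; this s gives it the value -1. *)
  have := Q ((A + 1) / (2 * B)); rewrite C0' mulr0 addr0.
  have -> : A - 2 * ((A + 1) / (2 * B)) * B = - 1 by field.
  by rewrite oppr_ge0 ler10.
(* The minimiser of the quadratic. *)
have := Q (B / C).
have -> : A - 2 * (B / C) * B + (B / C) ^+ 2 * C = (A * C - B ^+ 2) / C.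
  by field.
by rewrite pmulr_lge0 ?subr_ge0// invr_gt0 lt0r C0' C0.
Qed.

(** * The pointwise Clifford estimate *)

(* Here psi = c(v) phi, where v is the vector with components p; the relations
   between different c i enter only through |c(v) phi| = |v| |phi|. *)
Lemma clifford_cauchy_schwarz {R : realFieldType} {V : lmodType R}
    {h : V -> V -> R} (hP : inner_product R V h) (n : nat)
    (c : 'I_n -> V -> V) (p : 'I_n -> R) (a : 'I_n -> V) (phi psi : V) :
  (forall i u v, h (c i u) v = - h u (c i v)) ->
  (forall i u, h (c i u) (c i u) = h u u) ->
  psi = \sum_i p i *: c i phi ->
  h psi psi = (\sum_i p i ^+ 2) * h phi phi ->
  (n%:R * (\sum_i p i * h (a i) phi) - h (\sum_i c i (a i)) psi) ^+ 2 <=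
  (\sum_i h (a i) (a i)) *
    (n%:R * (n%:R - 1) * ((\sum_i p i ^+ 2) * h phi phi)).
Proof.
move=> cskew ciso psiE psi2; pose T i := n%:R * p i *: phi + c i psi.
have -> : n%:R * (\sum_i p i * h (a i) phi) - h (\sum_i c i (a i)) psi =
    \sum_i h (a i) (T i).
  rewrite (ip_suml hP) mulr_sumr -sumrB; apply: eq_bigr => i _.
  by rewrite (ipDr hP) (ipZr hP) cskew; ring.
have <- : \sum_i h (T i) (T i) =
    n%:R * (n%:R - 1) * ((\sum_i p i ^+ 2) * h phi phi).
  (* By skewness the cross terms are -2n p_i <c_i phi, psi>, with sum -2n |psi|^2; each |c_i psi|^2
     is |psi|^2. As |psi|^2 = |p|^2 |phi|^2, the coefficient is n^2 - 2n + n. *)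
  transitivity (n%:R ^+ 2 * (\sum_i p i ^+ 2) * h phi phi
      - 2 * n%:R * h psi psi + \sum_(i < n) h psi psi).
    rewrite [in 2 * _ * _]psiE (ip_suml hP) -psiE.
    rewrite mulr_sumr mulr_suml mulr_sumr -sumrB -big_split.
    apply: eq_bigr => i _ /=.
    rewrite /T !(ipDl hP, ipDr hP, ipZl hP, ipZr hP) ciso.
    by rewrite (ip_sym _ _ _ hP (c i psi)) cskew; ring.
  by rewrite sumr_const card_ord -mulr_natl psi2; ring.
exact: ip_cauchy_schwarz.
Qed.

(** Here [m], [q], [N], [d], [A], [X] stand for n, |v|, |xi|, |D xi|, |nabla xi| and <D xi, c(v)
    xi>. *)
Lemma refined_kato_scalar (R : realFieldType) (m q N d A X : R) :
  1 <= m -> 0 <= q -> 0 < N -> 0 <= d -> 0 <= A -> X <= d * (q * N) ->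
  (m * (q ^+ 2 * N) - X) ^+ 2 <= A ^+ 2 * (m * (m - 1) * (q ^+ 2 * N ^+ 2)) ->
  q ^+ 2 <= (m - 1) / m * A ^+ 2 + 2 * d ^+ 2 + 2 * d * A.
Proof.
move=> m1 q0 N0 d0 A0 Xle H; have m0 : 0 < m by lra.
have rhs0 : 0 <= (m - 1) / m * A ^+ 2 + 2 * d ^+ 2 + 2 * d * A.
  by rewrite !addr_ge0 ?mulr_ge0 ?sqr_ge0 ?invr_ge0//; lra.
have [->|qn0] := eqVneq q 0; first by rewrite expr0n.
have {qn0}q0 : 0 < q by rewrite lt0r qn0.
(* The bound on X gives k q N <= m q^2 N - X. If k >= 0 this can be squared and divided by (q N)^2;
   if k < 0, then m q < d already suffices. *)
set k := m * q - d.
have mq : m ^+ 2 * q ^+ 2 <= m * (m - 1) * A ^+ 2 + 2 * m * d * A + 2 * d ^+ 2.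
  have mA : 0 <= m * (m - 1) * A ^+ 2.
    by rewrite !mulr_ge0 ?sqr_ge0//; lra.
  have mdA : 0 <= 2 * m * d * A by rewrite !mulr_ge0//; lra.
  have [k0|k0] := ltP k 0.
    have : (m * q) ^+ 2 <= d ^+ 2.
      by rewrite ler_sqr ?nnegrE ?mulr_ge0//; rewrite /k in k0; lra.
    have := sqr_ge0 d; rewrite exprMn; lra.
  have k2 : k ^+ 2 <= m * (m - 1) * A ^+ 2.
    rewrite -(ler_pM2r (exprn_gt0 2 (mulr_gt0 q0 N0))) -exprMn.
    have kle : k * (q * N) <= m * (q ^+ 2 * N) - X by rewrite /k; lra.
    have -> : m * (m - 1) * A ^+ 2 * (q * N) ^+ 2 =
      A ^+ 2 * (m * (m - 1) * (q ^+ 2 * N ^+ 2)) by ring.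
    apply: le_trans H.
    by rewrite ler_sqr ?nnegrE// ?(le_trans _ kle)// !mulr_ge0// ltW.
  (* This cruder bound avoids the root of m (m - 1); it enters only the cross term 2 d k, while k^2
     keeps its sharp bound. *)
  have kmA : k <= m * A.
    rewrite -ler_sqr ?nnegrE ?mulr_ge0 ?(ltW m0)//; apply: (le_trans k2).
    by rewrite exprMn expr2 ler_wpM2r ?sqr_ge0// ler_wpM2l; lra.
  have -> : m ^+ 2 * q ^+ 2 = k ^+ 2 + 2 * d * k + d ^+ 2 by rewrite /k; ring.
  have : d * k <= d * (m * A) by rewrite ler_wpM2l.
  have := sqr_ge0 d; lra.
(* After multiplication by m^2, [1 <= m] absorbs the remaining powers of m into the constant 2. *)
rewrite -(ler_pM2l (exprn_gt0 2 m0)); apply: (le_trans mq).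
have -> : m ^+ 2 * ((m - 1) / m * A ^+ 2 + 2 * d ^+ 2 + 2 * d * A) =
  m * (m - 1) * A ^+ 2 + 2 * m * (m * (d * A)) + 2 * (m ^+ 2 * d ^+ 2).
  by field; lra.
have d2 := sqr_ge0 d.
have dA : 0 <= d * A by rewrite mulr_ge0.
have h1 : 1 * d ^+ 2 <= m ^+ 2 * d ^+ 2.
  by rewrite ler_wpM2r// -[1](expr1n _ 2) ler_sqr ?nnegrE; lra.
have h2 : m * (1 * (d * A)) <= m * (m * (d * A)).
  by rewrite ler_wpM2l ?(ltW m0)// ler_wpM2r.
lra.
Qed.

(** * Derivatives of square roots and at minima *)

Lemma derive_sqrt_comp (R : realType) (V : normedModType R) (F : V -> R)
    (a v : V) :
  differentiable F a -> 0 < F a ->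
  'D_v (fun y => Num.sqrt (F y)) a = 'D_v F a / (2 * Num.sqrt (F a)).
Proof.
move=> dF F0; have ds := is_derive1_sqrt F0.
have dsqrt : differentiable (@Num.sqrt R) (F a) by apply/derivable1_diffP.
rewrite -/(Num.sqrt \o F) deriveE; last exact: differentiable_comp.
by rewrite diff_comp//= -(deriveE _ dF) diff1E//= derive1E derive_val.
Qed.

(** Difference quotients from the right are nonnegative at a minimum, so every directional
    derivative is; comparing [v] with [- v] forces zero. *)
Lemma derive_at_min (R : realType) (V : normedModType R) (F : V -> R)
    (a v : V) :
  differentiable F a -> (forall y, F a <= F y) -> 'D_v F a = 0.
Proof.
move=> dF Fmin.
have D_ge0 w : 0 <= 'D_w F a.
  have dw : derivable F a w by exact: diff_derivable.
  rewrite /derive cvg_at_rightE//; apply: limr_ge.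
    rewrite -(cvg_at_rightE
      (fun h : R => h^-1 *: ((F \o shift a) (h *: w) - F a)))//.
    apply: cvg_trans dw; apply: cvg_app.
    move=> A [e egt0 Ae]; exists e => // x xe xgt0; apply: Ae => //.
    exact/lt0r_neq0.
  near=> h; apply: mulr_ge0; last by rewrite subr_ge0; exact: Fmin.
  by rewrite invr_ge0; apply: ltW; near: h; exists 1 => /=.
apply/eqP; rewrite eq_le D_ge0 andbT -oppr_ge0.
by have := D_ge0 (- v); rewrite !deriveE// linearN.
Unshelve. all: by end_near. Qed.

(** * Orthonormal frames and the Gram matrix *)

Lemma posdef_ip (R : realFieldType) (V : lmodType R) (h : V -> V -> R) :
  (forall a b, h a b = h b a) ->
  (forall t a b c, h (t *: a + b) c = t * h a c + h b c) ->
  (forall a, a <> 0 -> 0 < h a a) -> inner_product R V h.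
Proof.
move=> sym lin pos; split=> // a.
have [->|/eqP/pos/ltW//] := eqVneq a 0.
suff -> : h 0 0 = 0 by [].
by apply: (addrI (h 0 0)); rewrite -[X in X + _]mul1r -lin scale1r !addr0.
Qed.

Lemma metric_ip (R : realType) (n : nat) (M : manifold R n)
    (g : riemannian_metric M) (x : M) :
  inner_product R (tangent x) (@metric _ _ _ g x).
Proof.
apply: posdef_ip.
- exact: Defs.metric_sym.
- exact: metric_linear.
- exact: metric_pos.
Qed.

Lemma inner_ip (R : realType) (n : nat) (M : manifold R n)
    (E : vector_bundle M) (h : bundle_metric E) (x : M) :
  inner_product R (E x) (@inner _ _ _ _ h x).
Proof.
apply: posdef_ip.
- exact: inner_sym.
- exact: inner_linear.
- exact: inner_pos.
Qed.

Lemma ip_orthonormal {R : realFieldType} {V : lmodType R} {h : V -> V -> R}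
    (hP : inner_product R V h) (I : finType) (e : I -> V) (p : I -> R) :
  (forall i j, h (e i) (e j) = (i == j)%:R) ->
  h (\sum_i p i *: e i) (\sum_i p i *: e i) = \sum_i p i ^+ 2.
Proof.
move=> eE; rewrite (ip_sum_scale hP); apply: eq_bigr => i _.
rewrite (bigD1 i)//= eE eqxx mulr1 big1 ?addr0 ?expr2// => j ji.
by rewrite eE eq_sym (negPf ji) mulr0.
Qed.

(** If the rows of F are the frame vectors, orthonormality reads F G F^T = 1. The matrices are
    square, so G (F^T F) = 1 as well. *)
Lemma inverse_gram_orthonormal {R : realFieldType} (n : nat)
    (h : 'rV[R]_n -> 'rV[R]_n -> R) (hP : inner_product R 'rV[R]_n h)
    (e : 'I_n -> 'rV[R]_n) :
  (forall i j, h (e i) (e j) = (i == j)%:R) ->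
  invmx (\matrix_(i, j) h (delta_mx 0 i) (delta_mx 0 j)) =
  \matrix_(i, j) \sum_k e k 0 i * e k 0 j.
Proof.
move=> eE; set G := \matrix_(i, j) _.
pose F := \matrix_(k, i) e k 0 i : 'M[R]_n.
have FGF : F *m (G *m F^T) = 1%:M.
  apply/matrixP => k l; rewrite !mxE -eE [e k]row_sum_delta [e l]row_sum_delta.
  rewrite (ip_sum_scale hP); apply: eq_bigr => i _; rewrite !mxE mulr_sumr.
  by apply: eq_bigr => j _; rewrite !mxE; ring.
have GFF : G *m (F^T *m F) = 1%:M by rewrite mulmxA; exact: mulmx1C.
have /mulKmx GK : G \in unitmx by have [] := mulmx1_unit GFF.
rewrite -[invmx G]mulmx1 -GFF GK; apply/matrixP => i j; rewrite !mxE.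
by apply: eq_bigr => k _; rewrite !mxE.
Qed.

(** Raising an index with g^{ij} amounts to summing over the frame. The values lie in any module, to
    cover both df and nabla xi. *)
Lemma inverse_gram_comb {R : realFieldType} {n : nat}
    {h : 'rV[R]_n -> 'rV[R]_n -> R} (hP : inner_product R 'rV[R]_n h)
    {e : 'I_n -> 'rV[R]_n} (eE : forall i j, h (e i) (e j) = (i == j)%:R)
    (W : lmodType R) (w : 'I_n -> W) (i : 'I_n) :
  \sum_j invmx (\matrix_(i, j) h (delta_mx 0 i) (delta_mx 0 j)) i j *: w j =
  \sum_k e k 0 i *: \sum_j e k 0 j *: w j.
Proof.
rewrite (inverse_gram_orthonormal n h hP e eE).
under eq_bigr do rewrite mxE scaler_suml.
rewrite exchange_big; apply: eq_bigr => k _; rewrite scaler_sumr.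
by apply: eq_bigr => j _; rewrite scalerA.
Qed.

(** The left side is the squared norm of \sum_k e_k (x) a_k written in the coordinate basis;
    bilinearity reduces it to the products of the e_k. *)
Lemma gram_tensor_norm {R : realFieldType} {n : nat}
    {h : 'rV[R]_n -> 'rV[R]_n -> R} (hP : inner_product R 'rV[R]_n h)
    {e : 'I_n -> 'rV[R]_n} (eE : forall i j, h (e i) (e j) = (i == j)%:R)
    {W : lmodType R} {H : W -> W -> R} (HP : inner_product R W H)
    (a : 'I_n -> W) :
  \sum_i \sum_j h (delta_mx 0 i) (delta_mx 0 j) *
    H (\sum_k e k 0 i *: a k) (\sum_k e k 0 j *: a k) = \sum_k H (a k) (a k).
Proof.
transitivity (\sum_k \sum_l h (e k) (e l) * H (a k) (a l)); last first.
  apply: eq_bigr => k _; rewrite (bigD1 k)//= eE eqxx mul1r big1 ?addr0//.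
  by move=> l lk; rewrite eE eq_sym (negPf lk) mul0r.
transitivity (\sum_i \sum_j \sum_k \sum_l
    e k 0 i * e l 0 j * h (delta_mx 0 i) (delta_mx 0 j) * H (a k) (a l)).
  apply: eq_bigr => i _; apply: eq_bigr => j _.
  rewrite (ip_sum_scale HP) mulr_sumr; apply: eq_bigr => k _.
  by rewrite mulr_sumr; apply: eq_bigr => l _; ring.
under eq_bigr do rewrite exchange_big.
rewrite exchange_big; apply: eq_bigr => k _ /=.
under eq_bigr do rewrite exchange_big.
rewrite exchange_big; apply: eq_bigr => l _ /=.
rewrite [in RHS](row_sum_delta (e k)) [in RHS](row_sum_delta (e l)).
rewrite (ip_sum_scale hP) mulr_suml; apply: eq_bigr => i _.
by rewrite mulr_suml.
Qed.

(** * The derivative of |xi| *)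

Lemma inner_section_differentiable (R : realType) (n : nat) (M : manifold R n)
    (E : vector_bundle M) (h : bundle_metric E) (xi : section E) (x : M) :
  smooth_section xi -> differentiable_at (fun y => h y (xi y) (xi y)) x.
Proof.
move=> xis; have [+ _] := inner_smooth h openT xis xis (chart_at x) 1%N.
by apply; exists x => //; split => //; exact: chart_atP.
Qed.

(** Compatibility of nabla with the metric gives d|xi|^2 = 2 <nabla xi, xi>; then the chain rule for
    the square root applies. *)
Lemma mdiff_fibre_norm (R : realType) (n : nat) (M : manifold R n)
    (E : vector_bundle M) (h : bundle_metric E) (nabla : metric_connection h)
    (xi : section E) (x : M) (v : tangent x) :
  smooth_section xi -> xi x <> 0 ->
  mdiff (fun y => fibre_norm h (xi y)) v =
  h x (nabla xi x v) (xi x) / fibre_norm h (xi x).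
Proof.
move=> xis xi0; set F := fun y => h y (xi y) (xi y).
have xK : param (chart_at x) (chart (chart_at x) x) = x.
  by apply: chartK; exact: chart_atP.
have Fx : 0 < (F \o param (chart_at x)) (chart (chart_at x) x).
  by rewrite /= xK; exact: inner_pos.
have dF := inner_section_differentiable _ _ _ _ h _ x xis.
rewrite /mdiff /fibre_norm.
rewrite (derive_sqrt_comp _ _ (F \o param (chart_at x)) _ v dF Fx).
have := nabla_metric nabla v xis xis; rewrite -/F /mdiff => ->.
rewrite /= xK /F (inner_sym h (xi x)).
by field; rewrite gt_eqF// sqrtr_gt0; exact: inner_pos.
Qed.

Lemma mdiff_fibre_norm_zero (R : realType) (n : nat) (M : manifold R n)
    (E : vector_bundle M) (h : bundle_metric E) (xi : section E) (x : M)
    (v : tangent x) :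
  xi x = 0 -> differentiable_at (fun y => fibre_norm h (xi y)) x ->
  mdiff (fun y => fibre_norm h (xi y)) v = 0.
Proof.
move=> xi0 dN; apply: derive_at_min => // y /=.
rewrite chartK; last exact: chart_atP.
by rewrite {1}/fibre_norm xi0 (ip0l (inner_ip _ _ _ _ h x)) sqrtr0 sqrtr_ge0.
Qed.

Lemma linear_comb {R : pzRingType} {U V : lmodType R} {f : U -> V} :
  linear f -> forall (I : finType) (t : I -> R) (u : I -> U),
  f (\sum_i t i *: u i) = \sum_i t i *: f (u i).
Proof.
move=> flin I t u.
pose F := HB.pack_for {linear U -> V} f (GRing.isLinear.Build _ _ _ _ f flin).
by rewrite -[LHS]/(F _) linear_sum; apply: eq_bigr => i _; rewrite linearZ.
Qed.

(** * Gradient and covariant derivative in an orthonormal frame at a point *)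

Section Frame.
Variables (R : realType) (n : nat) (M : manifold R n).
Variables (g : riemannian_metric M) (x : M) (e : 'I_n -> tangent x).
Hypothesis eE : forall i j, g x (e i) (e j) = (i == j)%:R.

(** The inner sum stands for df(e_k). It stays in coordinates because [mdiff f] need not be linear
    in the direction when [f] is not differentiable. *)
Lemma tangent_norm_gradient (f : M -> R) :
  tangent_norm g (gradient g f x) ^+ 2 =
  \sum_k (\sum_j e k 0 j * mdiff f (tangent_basis x j)) ^+ 2.
Proof.
rewrite /tangent_norm sqr_sqrtr.
  2: exact: (ip_ge0 _ _ _ (metric_ip _ _ _ g x)).
rewrite -(ip_orthonormal (metric_ip _ _ _ g x) _ e _ eE).
suff -> : gradient g f x =
  \sum_k (\sum_j e k 0 j * mdiff f (tangent_basis x j)) *: e k by [].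
rewrite /gradient.
under eq_bigr => i _.
  rewrite (inverse_gram_comb (metric_ip _ _ _ g x) eE R^o).
  over.
rewrite /=; under eq_bigr do rewrite scaler_suml.
rewrite exchange_big; apply: eq_bigr => k _ /=.
set P := (X in _ = X *: _).
rewrite [in RHS](row_sum_delta (e k)) scaler_sumr; apply: eq_bigr => i _.
by rewrite scalerA [in RHS]mulrC.
Qed.

(** By linearity of nabla in the direction, nabla xi is \sum_k e_k (x) nabla_{e_k} xi. *)
Lemma tensor_norm_covariant_derivative (E : vector_bundle M)
    (h : bundle_metric E) (nabla : metric_connection h) (xi : section E) :
  smooth_section xi ->
  tensor_norm g h (covariant_derivative g nabla xi x) ^+ 2 =
  \sum_k h x (nabla xi x (e k)) (nabla xi x (e k)).
Proof.
move=> xis.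
have nablaE k : nabla xi x (e k) =
    \sum_j e k 0 j *: nabla xi x (tangent_basis x j).
  rewrite [in LHS](row_sum_delta (e k)).
  exact: (linear_comb (nabla_linear nabla xis)).
have hP := inner_ip _ _ _ _ h x.
have E1 : \sum_i \sum_j g x (tangent_basis x i) (tangent_basis x j) *
    h x (covariant_derivative g nabla xi x i)
      (covariant_derivative g nabla xi x j)
  = \sum_k h x (nabla xi x (e k)) (nabla xi x (e k)).
  rewrite -(gram_tensor_norm (metric_ip _ _ _ g x) eE hP).
  apply: eq_bigr => i _; apply: eq_bigr => j _.
  rewrite /covariant_derivative.
  rewrite !(inverse_gram_comb (metric_ip _ _ _ g x) eE).
  under eq_bigr do rewrite -nablaE.
  by under [in X in _ * _ _ X = _]eq_bigr do rewrite -nablaE.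
rewrite /tensor_norm E1 sqr_sqrtr// sumr_ge0// => k _; exact: (ip_ge0 _ _ _ hP).
Qed.
End Frame.

(** * The refined Kato inequality for sections *)

Theorem proposition3p3 (R : realType) (n : nat) (n_gt0 : (0 < n)%N) :
  exists cn : R, 0 < cn /\
    forall (X : manifold R n) (g : riemannian_metric X),
      complete_metric g ->
    forall (E : vector_bundle X) (h : bundle_metric E)
      (c : clifford_action g h) (nabla : metric_connection h)
      (xi : section E), smooth_section xi ->
    forall (O : set X) (e : 'I_n -> vector_field X),
      local_orthonormal_frame g O e ->
    forall x : X, O x ->
      let norm_xi := fun y : X => fibre_norm h (xi y) in
      (* |xi| is differentiable wherever xi does not vanish, but it need not
         have a gradient at the zeros of xi *)
      xi x <> 0 \/ differentiable_at norm_xi x ->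
      tangent_norm g (gradient g norm_xi x) ^+ 2 <=
        (n%:R - 1) / n%:R
          * tensor_norm g h (covariant_derivative g nabla xi x) ^+ 2
        + cn * fibre_norm h (dirac_operator nabla c e xi x) ^+ 2
        + cn * fibre_norm h (dirac_operator nabla c e xi x)
             * tensor_norm g h (covariant_derivative g nabla xi x).
Proof.
exists 2; split=> // X g _ E h c nabla xi xis O e [_ _ eE] x Ox N xi_N.
have {}eE i j : g x (e i x) (e j x) = (i == j)%:R by exact: eE.
have hP := inner_ip _ _ _ _ h x.
have n1 : (1 : R) <= n%:R by rewrite ler1n.
set d := fibre_norm h (dirac_operator _ _ _ _ _).
set A := tensor_norm _ _ _.
have d0 : 0 <= d by exact: sqrtr_ge0.
have A0 : 0 <= A by exact: sqrtr_ge0.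
have [xi0|xi0] := pselect (xi x = 0).
  have dN : differentiable_at N x by case: xi_N.
  rewrite (tangent_norm_gradient _ _ _ _ _ _ eE) big1 => [|k _].
    by rewrite !addr_ge0 ?mulr_ge0 ?sqr_ge0 ?invr_ge0 ?subr_ge0.
  rewrite big1 ?expr0n// => j _; by rewrite (mdiff_fibre_norm_zero _ _ _ _ h) ?mulr0.
have N2 : N x ^+ 2 = h x (xi x) (xi x).
  by rewrite /N /fibre_norm sqr_sqrtr// ltW// inner_pos.
have N0 : 0 < N x by rewrite sqrtr_gt0 inner_pos.
pose a k := nabla xi x (e k x).
pose p k := h x (a k) (xi x) / N x.
have pE : tangent_norm g (gradient g N x) ^+ 2 = \sum_k p k ^+ 2.
  rewrite (tangent_norm_gradient _ _ _ _ _ _ eE); apply: eq_bigr => k _.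
  congr (_ ^+ 2); rewrite /p /a {2}(row_sum_delta (e k x)).
  rewrite (linear_comb (nabla_linear nabla xis)) (ip_suml hP) mulr_suml.
  apply: eq_bigr => j _; rewrite (ipZl hP) -mulrA.
  by rewrite -(mdiff_fibre_norm _ _ _ _ h nabla).
pose v : tangent x := \sum_k p k *: e k x.
have vv : g x v v = \sum_k p k ^+ 2.
  exact: ip_orthonormal (metric_ip _ _ _ g x) _ _ _ eE.
(* Skewness moves one factor c(w) across, and c(w)^2 = -|w|^2. *)
have ciso (w : tangent x) u : h x (c x w u) (c x w u) = g x w w * h x u u.
  by rewrite cliff_skew cliff_square (ipZr hP); ring.
have psiE : c x v (xi x) = \sum_k p k *: c x (e k x) (xi x).
  exact: (linear_comb (cliff_linearl c (xi x))).
set q := tangent_norm _ _ in pE *.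
have q0 : 0 <= q by exact: sqrtr_ge0.
pose Dv := h x (dirac_operator nabla c e xi x) (c x v (xi x)).
have d2 : d ^+ 2 =
    h x (dirac_operator nabla c e xi x) (dirac_operator nabla c e xi x).
  by rewrite sqr_sqrtr//; exact: (ip_ge0 _ _ _ hP).
(* Cauchy-Schwarz for D xi and c(v) xi, with |c(v) xi| = |v| |xi|. *)
have XE : Dv <= d * (q * N x).
  apply: le_trans (ler_norm _) _.
  rewrite -ler_sqr ?nnegrE ?mulr_ge0 ?(ltW N0)// real_normK ?num_real//.
  have := ip_cauchy_schwarz hP 'I_1 (fun=> dirac_operator nabla c e xi x)
    (fun=> c x v (xi x)).
  rewrite !big_ord1 ciso vv -pE -N2 => /le_trans; apply.
  by rewrite !exprMn d2.
apply: (refined_kato_scalar _ _ _ (N x) _ _ Dv) => //.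
rewrite pE N2 /A (tensor_norm_covariant_derivative _ _ _ _ _ _ eE)//.
(* Both sides are <nabla xi, v (x) xi>, since <a_k, xi> = p_k |xi|; this is the form paired with
   T. *)
have -> : (\sum_k p k ^+ 2) * N x = \sum_k p k * h x (a k) (xi x).
  rewrite mulr_suml; apply: eq_bigr => k _.
  by rewrite expr2 -mulrA /p divfK// gt_eqF.
apply: (clifford_cauchy_schwarz hP n (fun k => c x (e k x))) => //.
- by move=> i u w; exact: cliff_skew.
- by move=> i u; rewrite ciso eE eqxx mul1r.
- by rewrite ciso vv.
Qed.
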